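(* Let $q = p^r$ be a prime power ($p$ prime, $r \ge 1$) and let $d \ge 0$ be an integer. Let $X_{1,d}$ be the number of distinct zeros in $\mathbb{F}_q$ of a uniformly random polynomial in $\mathbb{F}_q[x]_d$. Then the probability generating function $\Phi_{1,d}(t) := \sum_{k \ge 0} P(X_{1,d} = k)\, t^k$ satisfies $$\Phi_{1,d}(t) = \sum_{i=0}^{d} \frac{(q^{d+1-i} - 1)\binom{q}{i}}{q^{d+1}} (t-1)^i + \frac{t^q}{q^{d+1}}.$$
   Context: $\mathbb{F}_q$ is the finite field with $q$ elements. $\mathbb{F}_q[x]_d$ denotes the set of polynomials in one variable over $\mathbb{F}_q$ of degree at most $d$ (including the zero polynomial, which has all $q$ elements of $\mathbb{F}_q$ as zeros); it has $q^{d+1}$ elements, and a random polynomial is chosen uniformly from it. Zeros are elements $a \in \mathbb{F}_q$ with $f(a)=0$, counted without multiplicity. By convention $\binom{q}{i} = 0$ for $i > q$. *)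

(* Defs.v *)
From HB Require Import structures.
From mathcomp Require Import all_boot all_order all_algebra.
From mathcomp Require Import qpoly.
From mathcomp Require Import all_classical all_reals all_analysis.
Import Order.TTheory GRing.Theory Num.Theory.
Import numFieldNormedType.Exports.

Set Implicit Arguments.
Unset Strict Implicit.
Unset Printing Implicit Defensive.

Local Open Scope ring_scope.

Definition uniform_prob (R : realType) (T : finType) (E : {set T}) : R :=
  #|E|%:R / #|T|%:R.

Definition pgf_term (R : realType) (T : finType) (X : T -> nat) (t : R)
    (k : nat) : R :=
  uniform_prob R [set w : T | X w == k] * t ^+ k.

(* limn is a total operator: it is the sum of the series only together with
   cvgn (series (pgf_term X t)). *)
Definition pgf (R : realType) (T : finType) (X : T -> nat) (t : R) : R :=
  limn (series (pgf_term X t)).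

Definition nb_zeros (F : finFieldType) (f : {poly F}) : nat :=
  #|[set a : F | root f a]|.

(* {poly_d.+1 F} is the finite type of f : {poly F} with size f <= d.+1, i.e.
   of degree at most d, zero included. *)
Definition X1 (F : finFieldType) (d : nat) (f : {poly_d.+1 F}) : nat :=
  nb_zeros (f : {poly F}).

(* Main.v *)
Require Import Defs.
From HB Require Import structures.
From mathcomp Require Import all_boot all_order all_algebra.
From mathcomp Require Import qpoly.
From mathcomp Require Import all_classical all_reals all_analysis.
Import Order.TTheory GRing.Theory Num.Theory.
Import numFieldNormedType.Exports.

(** Let [Z f] be the zero set of [f], and put [s = t - 1]. The idea is to expand
    in powers of [s] instead of [t]: the binomial formula turns [t ^ #|Z f|] into
    the sum of [s ^ #|A|] over all subsets [A] of [Z f]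
    ([sum_subset_expr]). After exchanging the sums over [f] and [A], it only
    remains to count the polynomials of degree at most [d] that vanish on a
    given [A]. These are the multiples of [\prod_(a in A) ('X - a)], so there
    are [q ^ (d + 1 - #|A|)] of them ([card_npoly_vanishing]); with truncated
    subtraction this also covers [#|A| > d + 1], where only [0] vanishes on [A].
    Hence [q ^ (d + 1)] times the generating function is the sum of
    [s ^ #|A| * q ^ (d + 1 - #|A|)] over all subsets [A] of the field.

    To reach the stated form, write
    [q ^ (d + 1 - #|A|) = (q ^ (d + 1 - #|A|) - 1) + 1]. The summand [1]
    contributes the sum of all [s ^ #|A|], which is [t ^ q]. The other summand
    vanishes as soon as [#|A| > d], so grouping the sets [A] by cardinality
    ([sum_subset_card]) gives a sum over [0 <= i <= d] with coefficients
    ['C(q, i)]. *)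

Local Open Scope ring_scope.

(** A random variable on a finite space is bounded, so the partial sums of its
    generating series are eventually constant; regrouping the outcomes by the
    value of [X] identifies that constant as the mean of [t ^ X]. *)
Lemma cvg_series_pgf_term (R : realType) (T : finType) (X : T -> nat) (t : R) :
  (series (pgf_term X t) @ \oo --> (\sum_(w : T) t ^+ X w) / #|T|%:R)%classic.
Proof.
apply: cvg_near_cst; exists (\max_w X w).+1 => // n /= lt_max_n.
have ltXn w : (X w < n)%N by apply: leq_trans lt_max_n; rewrite ltnS leq_bigmax.
transitivity (\sum_(0 <= k < n) (\sum_(w | k == X w) t ^+ X w) / #|T|%:R).
  apply: eq_bigr => k _; rewrite /pgf_term /uniform_prob mulrAC; congr (_ / _).
  rewrite (eq_bigr (fun=> t ^+ k)) => [|w /eqP <-//].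
  rewrite sumr_const -[RHS]mulr_natl; congr (_%:R * _).
  by apply: eq_card => w; rewrite !inE eq_sym.
rewrite -mulr_suml (exchange_big_dep xpredT)//=; congr (_ / _).
by apply: eq_bigr => w _; rewrite big_nat1_eq ltXn.
Qed.

(** There are ['C(#|Z|, k)] subsets of [Z] of cardinality [k]. The free cutoff
    [m] allows for a sum that extends to [#|Z|] as well as for one that stops
    earlier, or runs past [#|Z|], because of the shape of [g]. *)
Lemma sum_subset_card (V : nmodType) (T : finType) (Z : {set T}) (g : nat -> V)
    (m : nat) :
    (forall k, (m <= k <= #|Z|)%N -> g k = 0) ->
  \sum_(A : {set T} | A \subset Z) g #|A| =
    \sum_(0 <= k < m) g k *+ 'C(#|Z|, k).
Proof.
move=> g0.
transitivity (\sum_(A : {set T} | A \subset Z)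
    \sum_(0 <= k < m | k == #|A|) g k).
  apply: eq_bigr => A /subset_leq_card leAZ; rewrite big_nat1_eq /=.
  by case: ltnP => // lemA; rewrite g0 // lemA.
rewrite (exchange_big_dep xpredT)//=; apply: eq_bigr => k _.
rewrite sumr_const -cards_draws; congr (_ *+ _).
by apply: eq_card => A; rewrite !inE [#|A| == k]eq_sym.
Qed.

Lemma sum_subset_expr (R : comPzRingType) (T : finType) (Z : {set T}) (s : R) :
  \sum_(A : {set T} | A \subset Z) s ^+ #|A| = (1 + s) ^+ #|Z|.
Proof.
rewrite (@sum_subset_card _ _ _ _ #|Z|.+1) => [|k /andP[ltZk leZk]].
  by rewrite exprDn big_mkord; apply: eq_bigr => k _; rewrite expr1n mul1r.
by have := leq_trans ltZk leZk; rewrite ltnn.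
Qed.

(** Multiplication by the monic polynomial [P] of degree [#|A|] whose roots are
    the elements of [A] maps the polynomials of size at most [n - #|A|]
    bijectively onto those of size at most [n] that vanish on [A]. *)
Lemma card_npoly_vanishing (F : finFieldType) (n : nat) (A : {set F}) :
  #|[set f : {poly_n F} | A \subset [set a : F | root f a]]| =
    (#|F| ^ (n - #|A|))%N.
Proof.
pose P : {poly F} := \prod_(a <- enum A) ('X - a%:P).
have Pmonic : P \is monic by exact: monic_prod_XsubC.
have sizeP : size P = #|A|.+1 by rewrite size_prod_XsubC -cardE.
have dvdPE (f : {poly F}) : (A \subset [set a | root f a]) = (P %| f).
  apply/fintype.subsetP/idP => [fA|/dvdpP[g ->] a aA].
    apply: uniq_roots_dvdp; last by rewrite uniq_rootsE enum_uniq.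
    by apply/allP => a; rewrite mem_enum => /fA; rewrite inE.
  by rewrite inE rootM root_prod_XsubC mem_enum aA orbT.
have size_mulP (g : {poly F}) : (size (g * P)%R <= n)%N = (size g <= n - #|A|)%N.
  (* The zero polynomial has size 0, so the degree formula does not apply to it,
     but it satisfies both bounds. *)
  have [->|g0] := eqVneq g 0; first by rewrite mul0r size_poly0.
  rewrite size_Mmonic // sizeP addnS /=.
  have : (0 < size g)%N by rewrite size_poly_gt0.
  by case: (size g) => // k _; rewrite ltn_subRL addnC addnS.
pose mulP (g : {poly_(n - #|A|) F}) : {poly_n F} := npolyp n (val g * P).
have mulPE g : mulP g = val g * P :> {poly F} by rewrite npolypK // size_mulP size_npoly.
have mulP_inj : injective mulP.
  move=> g h /(congr1 val) /=; rewrite !mulPE => /mulIf ghE.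
  by apply/val_inj/ghE/monic_neq0.
rewrite -card_npoly -cardsT -(card_imset _ mulP_inj); apply: eq_card => f.
rewrite inE dvdPE; apply/dvdpP/imsetP => [[g fE]|[g _ ->]]; last first.
  by exists (val g); rewrite mulPE.
have sg : (size g <= n - #|A|)%N by rewrite -size_mulP -fE.
by exists (npolyp _ g) => //; apply/val_inj; rewrite /= mulPE [\val _]npolypK.
Qed.

(** The factorial-moment expansion of the number of zeros: both sides count the
    pairs of a polynomial [f] and a set [A] of zeros of [f], each weighted by
    [s ^ #|A|]. *)
Lemma sum_expr_nb_zeros (R : comPzRingType) (F : finFieldType) (n : nat)
    (s : R) :
  \sum_(f : {poly_n F}) (1 + s) ^+ nb_zeros f =
    \sum_(A : {set F}) s ^+ #|A| * #|F|%:R ^+ (n - #|A|).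
Proof.
under eq_bigr do rewrite -sum_subset_expr.
rewrite (exchange_big_dep xpredT)//=; apply: eq_bigr => A _.
rewrite sumr_const -natrX -(card_npoly_vanishing F n A) mulr_natr.
by congr (_ *+ _); apply: eq_card => f; rewrite !inE.
Qed.

Theorem theorem3p3 (R : realType) (F : finFieldType) (p r q d : nat)
    (hp : prime p) (hr : (0 < r)%N) (hq : q = (p ^ r)%N) (hF : #|F| = q)
    (t : R) :
  cvgn (series (pgf_term (@X1 F d) t)) /\
  pgf (@X1 F d) t =
    \sum_(0 <= i < d.+1)
      (((q%:R ^+ (d.+1 - i) - 1) * 'C(q, i)%:R) / q%:R ^+ d.+1 * (t - 1) ^+ i)
    + t ^+ q / q%:R ^+ d.+1.
Proof.
have cvg_pgf := cvg_series_pgf_term R _ (@X1 F d) t.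
split; first by apply: cvgP cvg_pgf.
rewrite /pgf (cvg_lim _ cvg_pgf) //.
rewrite card_npoly hF natrX.
have tE : t = 1 + (t - 1) by rewrite addrC subrK.
have numE : \sum_(f : {poly_d.+1 F}) t ^+ X1 f =
    \sum_(A : {set F}) (t - 1) ^+ #|A| * q%:R ^+ (d.+1 - #|A|).
  by rewrite -hF -sum_expr_nb_zeros -tE.
have powE : t ^+ q = \sum_(A : {set F}) (t - 1) ^+ #|A|.
  rewrite {1}tE -hF -cardsT -sum_subset_expr.
  by apply: eq_bigl => A; rewrite finset.subsetT.
rewrite numE powE.
(* The trivial condition on A in the first sum puts it in the form of
   sum_subset_card, with Z the whole field. *)
transitivity ((\sum_(A : {set F} | A \subset [set: F])
    (t - 1) ^+ #|A| * (q%:R ^+ (d.+1 - #|A|) - 1)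
  + \sum_(A : {set F}) (t - 1) ^+ #|A|) / q%:R ^+ d.+1).
  congr (_ / _); under [X in _ = X + _]eq_bigl do rewrite finset.subsetT.
  rewrite -big_split /=; apply: eq_bigr => A _.
  by rewrite mulrBr mulr1 subrK.
rewrite mulrDl; congr (_ + _).
rewrite (@sum_subset_card _ _ _
    (fun k => (t - 1) ^+ k * (q%:R ^+ (d.+1 - k) - 1)) d.+1); last first.
  (* For k > d the truncated exponent is 0, so the bracket is 1 - 1. *)
  by move=> k /andP[ltdk _]; rewrite (eqP ltdk) expr0 subrr mulr0.
rewrite cardsT hF mulr_suml; apply: eq_bigr => i _.
by rewrite [RHS]mulrC -[_ *+ 'C(q, i)]mulr_natr !mulrA.
Qed.
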